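(* Consider the multi-level spanner problem (defined in the context) and suppose an oracle is available that, for any terminal set $X\subseteq V$, returns a minimum-weight single-level subsetwise spanner of $G$ for $X$. Then there is a randomized polynomial-time algorithm (making oracle calls) that outputs a feasible multi-level spanner whose expected total weight is at most $e\cdot \mathrm{weight}(\mathrm{OPT})$, where $\mathrm{OPT}$ is an optimal multi-level spanner and $e$ is Euler's number.
   Context: Input: a graph $G=(V,E)$ with positive edge weights and nested vertex subsets $S_k\subseteq S_{k-1}\subseteq\cdots\subseteq S_1\subseteq V$, together with a fixed spanner requirement (multiplicative: $d_H(u,v)\le \alpha\, d_G(u,v)$, or additive: $d_H(u,v)\le d_G(u,v)+\beta W$) that a subgraph $H$ must satisfy for all pairs of terminals $u,v$ in a given set to be a subsetwise spanner for that set. A multi-level spanner is a sequence of subgraphs $G_i=(V_i,E_i)$, $i=1,\dots,k$, with $E_k\subseteq E_{k-1}\subseteq\cdots\subseteq E_1$, such that each $G_i$ is a subsetwise spanner of $G$ for $S_i$. Its total weight is $\sum_{i=1}^k \mathrm{weight}(G_i)$ (equivalently, each edge is counted once for every level it belongs to). The goal is to minimize the total weight. *)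

(* Defs.v *)
From HB Require Import structures.
From mathcomp Require Import all_boot all_order all_algebra.
From mathcomp Require Import all_classical all_reals all_analysis.
Set Implicit Arguments.
Unset Strict Implicit.
Unset Printing Implicit Defensive.
Import Order.TTheory GRing.Theory Num.Theory.

Local Open Scope ring_scope.

(** * Weighted graphs and subsetwise spanners *)

(* A finite simple undirected graph on the vertex set 'I_n: an edge is the
   two-element set of its endpoints.  The values of [wt] outside [edges] are
   never used. *)
Record wgraph (R : realType) (n : nat) := WGraph {
  edges : {set {set 'I_n}};
  wt : {set 'I_n} -> R;
  edges_card2 : forall e, e \in edges -> #|e| = 2%N;
  wt_gt0 : forall e, e \in edges -> 0 < wt e
}.

Record subgraph (n : nat) := Subgraph {
  sg_vertices : {set 'I_n};
  sg_edges : {set {set 'I_n}}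
}.

Definition is_subgraph (R : realType) (n : nat) (G : wgraph R n)
    (H : subgraph n) : Prop :=
  sg_edges H \subset edges G /\
  (forall e, e \in sg_edges H -> e \subset sg_vertices H).

Definition weight (R : realType) (n : nat) (G : wgraph R n)
    (H : subgraph n) : R :=
  \sum_(e in sg_edges H) wt G e.

Definition adj (n : nat) (F : {set {set 'I_n}}) : rel 'I_n :=
  fun u v => [set u; v] \in F.

(* The walk visits u, then the vertices of p in order. *)
Definition walk_length (R : realType) (n : nat) (G : wgraph R n)
    (u : 'I_n) (p : seq 'I_n) : R :=
  \sum_(l <- pairmap (fun x y => wt G [set x; y]) u p) l.

(* Shortest-path distance using only the edges in F; it is +oo when u and v
   are not connected by F. *)
Definition dist (R : realType) (n : nat) (G : wgraph R n)
    (F : {set {set 'I_n}}) (u v : 'I_n) : \bar R :=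
  ereal_inf [set (walk_length G u p)%:E |
             p in [set p : seq 'I_n | path (adj F) u p /\ last u p = v]]%classic.

Definition max_weight (R : realType) (n : nat) (G : wgraph R n) : R :=
  \big[Order.max/0]_(e in edges G) wt G e.

Inductive requirement (R : realType) :=
  | Multiplicative (alpha : R)
  | Additive (beta : R).

Definition meets (R : realType) (n : nat) (G : wgraph R n)
    (req : requirement R) (H : subgraph n) (u v : 'I_n) : Prop :=
  match req with
  | Multiplicative alpha =>
      (dist G (sg_edges H) u v <= alpha%:E * dist G (edges G) u v)%E
  | Additive beta =>
      (dist G (sg_edges H) u v
         <= dist G (edges G) u v + (beta * max_weight G)%:E)%E
  end.

Definition subsetwise_spanner (R : realType) (n : nat) (G : wgraph R n)
    (req : requirement R) (X : {set 'I_n}) (H : subgraph n) : Prop :=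
  [/\ is_subgraph G H, X \subset sg_vertices H
    & forall u v, u \in X -> v \in X -> meets G req H u v].

Definition min_spanner (R : realType) (n : nat) (G : wgraph R n)
    (req : requirement R) (X : {set 'I_n}) (H : subgraph n) : Prop :=
  subsetwise_spanner G req X H /\
  (forall H', subsetwise_spanner G req X H' -> weight G H <= weight G H').

Definition min_spanner_oracle (R : realType) (n : nat) (G : wgraph R n)
    (req : requirement R) (O : {set 'I_n} -> subgraph n) : Prop :=
  forall X, min_spanner G req X (O X).

(** * Multi-level spanners *)

(* Levels are numbered from 0: index i : 'I_k stands for level i + 1. *)
Definition nested_terminals (n k : nat) (S : 'I_k -> {set 'I_n}) : Prop :=
  forall i j : 'I_k, (i <= j)%N -> S j \subset S i.

Definition multilevel_spanner (R : realType) (n k : nat) (G : wgraph R n)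
    (req : requirement R) (S : 'I_k -> {set 'I_n})
    (H : 'I_k -> subgraph n) : Prop :=
  (forall i, subsetwise_spanner G req (S i) (H i)) /\
  (forall i j : 'I_k, (i <= j)%N -> sg_edges (H j) \subset sg_edges (H i)).

Definition total_weight (R : realType) (n k : nat) (G : wgraph R n)
    (H : 'I_k -> subgraph n) : R :=
  \sum_(i < k) weight G (H i).

Definition optimal_multilevel_spanner (R : realType) (n k : nat)
    (G : wgraph R n) (req : requirement R) (S : 'I_k -> {set 'I_n})
    (H : 'I_k -> subgraph n) : Prop :=
  multilevel_spanner G req S H /\
  (forall H', multilevel_spanner G req S H' ->
     total_weight G H <= total_weight G H').

(** * Randomized oracle machines

   Programs of a structured random access machine with coin flips and an
   oracle.  Memory consists of arrays of natural numbers and arrays of reals;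
   an array is named by a number fixed in the program and indexed by a list of
   natural numbers (a scalar variable is an array indexed by [::]).

   Each primitive step has unit cost.  The arithmetic is restricted to
   addition, (truncated) subtraction and comparison, with no multiplication,
   rounding, conversion or real constant other than 0.  Hence the bit length
   of the numbers grows by at most a constant (depending on the program) per
   step, so that a polynomial number of steps is polynomial time in the bit
   model too when the weights are rational. *)

Inductive nexp :=
  | NConst (c : nat)
  | NGet (a : nat) (ix : seq nexp)
  | NAdd (e1 e2 : nexp)
  | NSub (e1 e2 : nexp).

Inductive rexp :=
  | RZero
  | RGet (a : nat) (ix : seq nexp)
  | RAdd (e1 e2 : rexp)
  | RSub (e1 e2 : rexp).

Inductive bexp :=
  | NLe (e1 e2 : nexp)
  | RLe (e1 e2 : rexp)
  | BNot (b : bexp)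
  | BAnd (b1 b2 : bexp).

(* [Flip a ix] stores a fair random bit in cell a[ix].
   [Query a b] reads the terminal set {v | a[v] <> 0} and overwrites array b
   with the oracle's answer: b[v] says whether v is a vertex of the answer and
   b[u, v] whether {u, v} is an edge of it. *)
Inductive cmd :=
  | Skip
  | NSet (a : nat) (ix : seq nexp) (e : nexp)
  | RSet (a : nat) (ix : seq nexp) (e : rexp)
  | Flip (a : nat) (ix : seq nexp)
  | Query (a b : nat)
  | Seq (c1 c2 : cmd)
  | If (b : bexp) (c1 c2 : cmd)
  | While (b : bexp) (c : cmd).

Record store (R : realType) := Store {
  nmem : nat -> seq nat -> nat;
  rmem : nat -> seq nat -> R
}.

Definition update (A : Type) (m : nat -> seq nat -> A)
    (a : nat) (ix : seq nat) (x : A) : nat -> seq nat -> A :=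
  fun a' ix' => if (a' == a) && (ix' == ix) then x else m a' ix'.

Fixpoint neval (m : nat -> seq nat -> nat) (e : nexp) : nat :=
  match e with
  | NConst c => c
  | NGet a ix => m a (map (neval m) ix)
  | NAdd e1 e2 => (neval m e1 + neval m e2)%N
  | NSub e1 e2 => (neval m e1 - neval m e2)%N
  end.

Fixpoint reval (R : realType) (s : store R) (e : rexp) : R :=
  match e with
  | RZero => 0
  | RGet a ix => rmem s a (map (neval (nmem s)) ix)
  | RAdd e1 e2 => reval s e1 + reval s e2
  | RSub e1 e2 => reval s e1 - reval s e2
  end.

Fixpoint beval (R : realType) (s : store R) (b : bexp) : bool :=
  match b with
  | NLe e1 e2 => (neval (nmem s) e1 <= neval (nmem s) e2)%N
  | RLe e1 e2 => reval s e1 <= reval s e2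
  | BNot b => ~~ beval s b
  | BAnd b1 b2 => beval s b1 && beval s b2
  end.

(* Encodings of sets of vertices and of edges as arrays indexed by numbers;
   out-of-range indices give 0. *)
Definition vertex_bit (n : nat) (X : {set 'I_n}) (v : nat) : nat :=
  if insub v is Some v' then (v' \in X) : nat else 0%N.

Definition edge_bit (n : nat) (F : {set {set 'I_n}}) (u v : nat) : nat :=
  match insub u, insub v with
  | Some u', Some v' => ([set u'; v'] \in F) : nat
  | _, _ => 0%N
  end.

Definition decode_vertices (n : nat) (f : nat -> nat) : {set 'I_n} :=
  [set v : 'I_n | f v != 0%N].

Definition decode_edges (n : nat) (f : nat -> nat -> nat) : {set {set 'I_n}} :=
  [set e | [exists u : 'I_n, exists v : 'I_n,
             (f u v != 0%N) && (e == [set u; v])]].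

Definition answer (n : nat) (H : subgraph n) (ix : seq nat) : nat :=
  match ix with
  | [:: v] => vertex_bit (sg_vertices H) v
  | [:: u; v] => edge_bit (sg_edges H) u v
  | _ => 0%N
  end.

(* Stack of commands still to be executed, memory, and coins not yet used. *)
Record config (R : realType) := Config {
  todo : seq cmd;
  memory : store R;
  coins_left : seq bool
}.

Definition step (R : realType) (n : nat) (O : {set 'I_n} -> subgraph n)
    (cf : config R) : config R :=
  let: Config cs s r := cf in
  let: Store nm rm := s in
  match cs with
  | [::] => cf
  | Skip :: cs => Config cs s r
  | NSet a ix e :: cs =>
      Config cs (Store (update nm a (map (neval nm) ix) (neval nm e)) rm) r
  | RSet a ix e :: cs =>
      Config cs (Store nm (update rm a (map (neval nm) ix) (reval s e))) r
  | Flip a ix :: cs =>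
      Config cs
        (Store (update nm a (map (neval nm) ix) (head false r : nat)) rm)
        (behead r)
  | Query a b :: cs =>
      let X := decode_vertices n (fun v => nm a [:: v]) in
      Config cs
        (Store (fun a' ix => if a' == b then answer (O X) ix else nm a' ix) rm)
        r
  | Seq c1 c2 :: cs => Config (c1 :: c2 :: cs) s r
  | If b c1 c2 :: cs => Config ((if beval s b then c1 else c2) :: cs) s r
  | While b c :: cs =>
      Config (if beval s b then c :: While b c :: cs else cs) s r
  end.

(* Input layout.  Arrays of naturals: 0[] = n, 1[] = k, 2[u, v] = adjacency
   matrix of G, 3[i, v] = membership of v in S i.  Array of reals:
   0[u, v] = weight of the edge {u, v}.  Everything else is 0. *)
Definition input_nmem (R : realType) (n k : nat) (G : wgraph R n)
    (S : 'I_k -> {set 'I_n}) (a : nat) (ix : seq nat) : nat :=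
  match a, ix with
  | 0%N, [::] => n
  | 1%N, [::] => k
  | 2%N, [:: u; v] => edge_bit (edges G) u v
  | 3%N, [:: i; v] => if insub i is Some i' then vertex_bit (S i') v else 0%N
  | _, _ => 0%N
  end.

Definition input_rmem (R : realType) (n : nat) (G : wgraph R n)
    (a : nat) (ix : seq nat) : R :=
  match a, ix with
  | 0%N, [:: u; v] =>
      match insub u, insub v with
      | Some u', Some v' =>
          if [set u'; v'] \in edges G then wt G [set u'; v'] else 0
      | _, _ => 0
      end
  | _, _ => 0
  end.

(* The configuration reached after T steps. *)
Definition run (R : realType) (n k : nat) (G : wgraph R n)
    (S : 'I_k -> {set 'I_n}) (O : {set 'I_n} -> subgraph n)
    (c : cmd) (T : nat) (coins : seq bool) : config R :=
  iter T (step O)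
    (Config [:: c] (Store (input_nmem G S) (input_rmem G)) coins).

Definition halted (R : realType) (cf : config R) : Prop := todo cf = [::].

(* Output layout.  Arrays of naturals: 4[i, v] says whether v is a vertex of
   the i-th subgraph, and 5[i, u, v] whether {u, v} is an edge of it. *)
Definition output (R : realType) (n k : nat) (cf : config R) (i : 'I_k) :
    subgraph n :=
  Subgraph
    (decode_vertices n (fun v => nmem (memory cf) 4 [:: nat_of_ord i; v]))
    (decode_edges n (fun u v => nmem (memory cf) 5 [:: nat_of_ord i; u; v])).

(* Expectation of f over T independent fair coin flips.  A run of at most T
   steps uses at most T coins. *)
Definition coin_expectation (R : realType) (T : nat)
    (f : T.-tuple bool -> R) : R :=
  (\sum_(coins : T.-tuple bool) f coins) / 2 ^+ T.

(* Main.v *)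
Require Import Defs.
From HB Require Import structures.
From mathcomp Require Import all_boot all_order all_algebra.
From mathcomp Require Import all_classical all_reals all_analysis.
From mathcomp Require Import ring lra zify.
Set Implicit Arguments.
Unset Strict Implicit.
Unset Printing Implicit Defensive.
(* [all_classical] shadows lemmas such as [subsetP] and [setIidPr]. *)
From mathcomp Require Import fintype finset.
Import Order.TTheory GRing.Theory Num.Theory.

Local Open Scope ring_scope.

(** Let w_p be the weight of the oracle's answer O_p for the terminals of level
    p (levels numbered from 0, so w is nonincreasing).  Cutting the levels into
    groups 0 = p_0 < p_1 < ... < p_r = k and putting O_{p_j} on all levels
    below p_{j+1} gives a feasible solution of weight at most
    sum_j p_{j+1} w_{p_j}.  The randomized choice p_j = floor(e^{y+j}), y
    uniform, has expected cost at most e * sum_p w_p <= e * weight(OPT).  Hence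
    the best choice of the cuts, which dynamic programming finds without any
    coin flip, is at most as expensive.

    The averaging over y is done discretely: for r = 1 + 1/N, average over N
    consecutive points x_t of a geometric sequence of ratio r, where a jump
    multiplies x_t by r^N <= e.  The resulting sum of x_t w_{floor x_t} is N+1
    times a lower Riemann sum of the step function w, which yields the factor
    e (1 + 1/N) for every N. *)

(** * The averaging argument *)

Section StepFunction.
Variables (R : realType) (m : nat -> R).
Hypothesis m_anti : forall i j, (i <= j)%N -> m j <= m i.

(* The integral over [0, x] of the step function y |-> m (floor y). *)
Definition step_area (x : R) : R :=
  \sum_(0 <= i < Num.trunc x) m i + (x - (Num.trunc x)%:R) * m (Num.trunc x).

(** The rectangle of height [m (floor y)] lies below the step function on [x, y]. When the floors a
    < b of x and y differ, the area splits at a + 1 and at b, and every piece has height at least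
    [m b]. *)
Lemma step_area_sub x y : 0 <= x -> x <= y ->
  (y - x) * m (Num.trunc y) <= step_area y - step_area x.
Proof.
move=> x0 xy; have y0 := le_trans x0 xy.
have /andP[ltx gtx] := truncn_itv x0; have /andP[lty gty] := truncn_itv y0.
have le_ab : (Num.trunc x <= Num.trunc y)%N by apply: le_truncn.
rewrite /step_area; move: ltx gtx lty gty le_ab.
move: (Num.trunc x) (Num.trunc y) => a b ltx gtx lty gty.
rewrite leq_eqVlt => /orP[/eqP <-|lt_ab]; first by nra.
rewrite (big_cat_nat (n := a) _ (ltnW lt_ab)) //= (big_ltn lt_ab).
have tail : (b%:R - a%:R - 1) * m b <= \sum_(a.+1 <= i < b) m i.
  apply: le_trans (_ : \sum_(a.+1 <= i < b) m b <= _).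
    by rewrite sumr_const_nat -[m b *+ _]mulr_natl natrB // -natr1 opprD addrA.
  by apply: ler_sum_nat => i /andP[_ ib]; apply/m_anti/ltnW.
have mab : m b <= m a by apply/m_anti/ltnW.
move: gtx; rewrite -natr1 => gtx.
have : 0 <= (a%:R + 1 - x) * (m a - m b) by rewrite mulr_ge0 ?subr_ge0 // ltW.
by nra.
Qed.

Hypothesis m_ge0 : forall i, 0 <= m i.

Lemma step_area_ge0 x : 0 <= x -> 0 <= step_area x.
Proof.
move=> x0; rewrite addr_ge0 ?sumr_ge0// mulr_ge0// subr_ge0.
by have /andP[] := truncn_itv x0.
Qed.

Lemma step_area_le k x : (forall i, (k <= i)%N -> m i = 0) -> 0 <= x ->
  step_area x <= \sum_(0 <= i < k) m i.
Proof.
move=> m0 x0; have /andP[ltx gtx] := truncn_itv x0.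
rewrite /step_area; move: (Num.trunc x) ltx gtx => a ltx gtx.
have [ka|ak] := leqP k a.
  rewrite m0 // mulr0 addr0 (big_cat_nat (n := k) _ ka) //=.
  rewrite [X in _ + X]big1_seq ?addr0 // => i.
  by rewrite mem_index_iota => /andP[_ /andP[ki _]]; apply: m0.
rewrite (big_cat_nat (n := a) _ (ltnW ak)) //= lerD2l big_ltn //.
rewrite -[X in X <= _]addr0 lerD ?sumr_ge0//.
rewrite ler_piMl // lerBlDl natr1; exact: ltW.
Qed.

End StepFunction.

(** Telescoping with stride [N]: only the first [N] terms and the [N] terms from [T] on survive. *)
Lemma sum_sub_shift (V : zmodType) (f : nat -> V) (N T : nat) :
  \sum_(t < T) (f t - f (t + N)%N) =
  \sum_(t < N) f t - \sum_(t < N) f (T + t)%N.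
Proof.
elim: T => [|T IH]; first by rewrite big_ord0 subrr.
rewrite big_ord_recr /= {}IH -addrA; congr (_ + _).
case: N => [|N]; first by rewrite !big_ord0 addn0 subrr addr0.
rewrite big_ord_recl big_ord_recr /= addn0 addnS.
under [in RHS]eq_bigr do rewrite addSnnS.
by rewrite !opprD addrACA [- _ + f T]addrC subrr add0r.
Qed.

Section JumpCost.
Variables (R : realType) (k : nat) (m c : nat -> R).
Hypothesis m_ge0 : forall i, 0 <= m i.
Hypothesis m_anti : forall i j, (i <= j)%N -> m j <= m i.
Hypothesis m_eq0 : forall i, (k <= i)%N -> m i = 0.
Hypothesis c_eq0 : forall i, (k <= i)%N -> c i = 0.
(** Bellman inequality for the cost-to-go [c]. The case p = q covers consecutive points with equal
    floors, and q > k covers jumps past the last level. *)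
Hypothesis c_jump : forall p q, (p <= q)%N -> c p <= q%:R * m p + c q.

(** All [N] chains of jumps t, t + N, t + 2N, ... are followed at once. Each starts at level 0 and
    ends beyond [k], so the summed jump inequalities telescope to N times [c 0] on one side and to
    the area below the step function on the other. *)
Lemma jump_cost_approx (N : nat) : (0 < N)%N ->
  N%:R * c 0%N <= expR 1 * (N%:R + 1) * \sum_(0 <= i < k) m i.
Proof.
move=> N0; have Npos : 0 < N%:R :> R by rewrite ltr0n.
set S := \sum_(_ <= _ < _) _; pose r : R := 1 + N%:R^-1.
have S0 : 0 <= S by apply: sumr_ge0.
have r1 : 1 < r by rewrite ltrDl invr_gt0.
have r0 : 0 < r by apply: lt_trans r1.
(* From 1 + x <= e^x at x = 1/N. *)
have rN : r ^+ N <= expR 1.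
  have -> : 1 = N%:R * N%:R^-1 :> R by rewrite mulfV ?lt0r_neq0.
  rewrite expRM_natl.
  by rewrite lerXn2r ?nnegrE ?expR_ge0 ?expR_ge1Dx // ltW.
(* The scaling makes [z N.+1] equal to 1, so [z 1], ..., [z N] lie below 1 and have floor 0. *)
pose z t : R := r ^+ t / r ^+ N.+1.
have z_ge0 t : 0 <= z t by rewrite divr_ge0 ?exprn_ge0 // ltW.
have zS t : z t.+1 = r * z t by rewrite /z exprS mulrA.
have zD t : z (t + N)%N = r ^+ N * z t by rewrite /z exprD; ring.
have z_lt1 t : (t < N)%N -> z t.+1 < 1.
  by move=> tN; rewrite /z ltr_pdivrMr ?exprn_gt0 // mul1r ltr_eXn2l.
pose p t := Num.trunc (z t.+1).
have p_lt t : (t < N)%N -> p t = 0%N.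
  by move=> tN; apply: truncn_def; rewrite z_ge0 z_lt1.
have p_big t : (k <= p (N + N * k + t)%N)%N.
  rewrite -[X in (X <= _)%N](@natrK R k) /p; apply: le_truncn.
  have -> : (N + N * k + t).+1 = (N.+1 + (N * k + t))%N by lia.
  have -> : z (N.+1 + (N * k + t))%N = r ^+ (N * k) * r ^+ t.
    rewrite -exprD /z exprD mulrAC divff ?mul1r // expf_neq0 // lt0r_neq0 //.
  apply: le_trans (_ : r ^+ (N * k) <= _); last first.
    by rewrite ler_peMr ?exprn_ge0 ?exprn_ege1 // ltW.
  (* Bernoulli's inequality; at j = N k it shows that the points have passed [k]. *)
  have le_r j : 1 + j%:R / N%:R <= r ^+ j.
    elim: j => [|j IH]; first by rewrite mul0r addr0 expr0.
    rewrite exprS -natr1 mulrDl mul1r addrA /r.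
    apply: le_trans (_ : (1 + N%:R^-1) * (1 + j%:R / N%:R) <= _); last first.
      by rewrite ler_pM2l.
    have : 0 <= N%:R^-1 * (j%:R / N%:R) :> R.
      by rewrite mulr_ge0 ?divr_ge0 ?invr_ge0 ?ler0n.
    by lra.
  apply: le_trans (le_r _).
  by rewrite natrM mulrAC divff ?mul1r ?lt0r_neq0 // lerDr.
(* The jump from [p t] costs at most r^N times [z t.+1] times [m (p t)]. Since r = 1 + 1/N, [z t.+1]
   is N + 1 times the increment [z t.+1 - z t], and [step_area_sub] bounds the resulting
   rectangle. *)
have term t : c (p t) - c (p (t + N)%N)
    <= r ^+ N * (N%:R + 1) * (step_area m (z t.+1) - step_area m (z t)).
  rewrite lerBlDr; apply: le_trans (c_jump (q := p (t + N)%N) _) _.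
    by rewrite /p le_truncn // !zS zD ler_wpM2l ?(ltW r0)// ler_peMl ?z_ge0 ?exprn_ege1 ?ltW.
  rewrite lerD2r.
  apply: le_trans (_ : z (t + N).+1 * m (p t) <= _).
    by rewrite ler_wpM2r // truncn_le.
  rewrite -addSn zD -2!(mulrA (r ^+ N)) ler_wpM2l ?exprn_ge0 ?(ltW r0) //.
  have z_le : z t <= z t.+1 by rewrite zS ler_peMl // ltW.
  have := step_area_sub m_anti (z_ge0 t) z_le.
  have N1 : 0 < N%:R + 1 :> R by rewrite addr_gt0.
  move/(ler_wpM2l (ltW N1)); apply: le_trans; rewrite mulrA ler_wpM2r //.
  rewrite zS /r; rewrite le_eqVlt; apply/orP; left; apply/eqP.
  by field; rewrite lt0r_neq0.
have le_sum : \sum_(t < N + N * k) (c (p t) - c (p (t + N)%N))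
    <= r ^+ N * (N%:R + 1) * S.
  apply: le_trans (ler_sum _ (fun (t : 'I_(N + N * k)) _ => term t)) _.
  rewrite -mulr_sumr ler_wpM2l ?mulr_ge0 ?exprn_ge0 ?(ltW r0) ?addr_ge0 //.
  rewrite -(big_mkord xpredT (fun t => step_area m (z t.+1) - step_area m (z t))).
  rewrite telescope_sumr // lerBlDr.
  by rewrite (le_trans (step_area_le m_ge0 m_eq0 _)) // lerDl step_area_ge0.
(* The subtracted terms sit at levels from [k] on and vanish; the remaining [N] terms all equal
   [c 0]. *)
move: le_sum; rewrite (sum_sub_shift (c \o p)) /=.
rewrite [X in _ - X]big1 ?subr0; last by move=> t _; rewrite c_eq0 ?p_big.
rewrite (eq_bigr (fun=> c 0%N)) => [|t _]; last by rewrite p_lt.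
rewrite sumr_const card_ord -[c _ *+ _]mulr_natl => /le_trans; apply.
by rewrite ler_wpM2r // ler_wpM2r // addr_ge0.
Qed.

(** Taking N above e S / epsilon pushes the surplus e S / N of the approximate bound below
    epsilon. *)
Lemma jump_cost_le : c 0%N <= expR 1 * \sum_(0 <= i < k) m i.
Proof.
set S := \sum_(_ <= _ < _) _.
have S0 : 0 <= expR 1 * S by rewrite mulr_ge0 ?expR_ge0 ?sumr_ge0.
apply/ler_addgt0Pr => e e0.
have [N Nlt] : exists N, expR 1 * S / e < N%:R.
  by exists (Num.trunc (expR 1 * S / e)).+1; rewrite truncnS_gt.
have N0 : 0 < N%:R :> R by apply: le_lt_trans Nlt; rewrite divr_ge0 // ltW.
move: (N0); rewrite ltr0n => /jump_cost_approx approx.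
rewrite -(ler_pM2l N0); apply: le_trans approx _; rewrite -/S.
by move: Nlt; rewrite ltr_pdivrMr // => Nlt; lra.
Qed.

End JumpCost.

(** * Structured programs and their running time *)

(** A sublanguage without coin flips and with counting loops only, so that termination and a
    polynomial time bound follow from the syntax. *)
Inductive prog :=
  | PSet (a : nat) (ix : seq nexp) (e : nexp)
  | PRSet (a : nat) (ix : seq nexp) (e : rexp)
  | PQuery (a b : nat)
  | PSeq (c1 c2 : prog)
  | PIf (b : bexp) (c : prog)
  | PFor (x b : nat) (c : prog).

(* [PFor x b c] runs [c] for x[] = 0, ..., b[] - 1. *)
Fixpoint compile (c : prog) : cmd :=
  match c with
  | PSet a ix e => NSet a ix e
  | PRSet a ix e => RSet a ix e
  | PQuery a b => Query a b
  | PSeq c1 c2 => Seq (compile c1) (compile c2)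
  | PIf b c => If b (compile c) Skip
  | PFor x b c =>
      Seq (NSet x [::] (NConst 0))
        (While (NLe (NAdd (NGet x [::]) (NConst 1)) (NGet b [::]))
           (Seq (compile c) (NSet x [::] (NAdd (NGet x [::]) (NConst 1)))))
  end.

Fixpoint nwrites (c : prog) : seq nat :=
  match c with
  | PSet a _ _ => [:: a]
  | PRSet _ _ _ => [::]
  | PQuery _ b => [:: b]
  | PSeq c1 c2 => nwrites c1 ++ nwrites c2
  | PIf _ c => nwrites c
  | PFor x _ c => x :: nwrites c
  end.

Fixpoint rwrites (c : prog) : seq nat :=
  match c with
  | PSet _ _ _ | PQuery _ _ => [::]
  | PRSet a _ _ => [:: a]
  | PSeq c1 c2 => rwrites c1 ++ rwrites c2
  | PIf _ c | PFor _ _ c => rwrites c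
  end.

(* Loop bounds are the inputs 0[] = n and 1[] = k, which are never changed. *)
Fixpoint well_formed (c : prog) : bool :=
  match c with
  | PSet a _ _ => (1 < a)%N
  | PRSet _ _ _ => true
  | PQuery _ b => (1 < b)%N
  | PSeq c1 c2 => well_formed c1 && well_formed c2
  | PIf _ c => well_formed c
  | PFor x b c =>
      [&& (1 < x)%N, (b <= 1)%N, x \notin nwrites c & well_formed c]
  end.

(** To be evaluated at a common bound of n and k. The constants count control steps: one to unfold a
    sequence, two for a test and a possible [Skip], three per iteration (test, unfolding,
    increment), and three per loop (unfolding, initialization, final test). *)
Fixpoint time_bound (c : prog) : {poly nat} :=
  match c with
  | PSet _ _ _ | PRSet _ _ _ | PQuery _ _ => 1%:P
  | PSeq c1 c2 => time_bound c1 + time_bound c2 + 1%:P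
  | PIf _ c => time_bound c + 2%:P
  | PFor _ _ c => 'X * (time_bound c + 3%:P) + 3%:P
  end.

Section Semantics.
Variables (R : realType) (n : nat) (O : {set 'I_n} -> subgraph n).

Definition nset (s : store R) a ix x : store R :=
  Store (update (nmem s) a ix x) (rmem s).

Definition rset (s : store R) a ix x : store R :=
  Store (nmem s) (update (rmem s) a ix x).

Definition load (s : store R) a f : store R :=
  Store (fun a' ix => if a' == a then f ix else nmem s a' ix) (rmem s).

(** A loop reads its bound once and assigns the counter outright. This agrees with the compiled
    [While] because a well-formed body changes neither the bound nor the counter. *)
Fixpoint sem (c : prog) (s : store R) : store R :=
  match c with
  | PSet a ix e => nset s a (map (neval (nmem s)) ix) (neval (nmem s) e)
  | PRSet a ix e => rset s a (map (neval (nmem s)) ix) (reval s e)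
  | PQuery a b =>
      load s b (answer (O (decode_vertices n (fun v => nmem s a [:: v]))))
  | PSeq c1 c2 => sem c2 (sem c1 s)
  | PIf b c => if beval s b then sem c s else s
  | PFor x b c =>
      iteri (nmem s b [::]) (fun i s => nset (sem c s) x [::] i.+1)
        (nset s x [::] 0%N)
  end.

Lemma sem_seq c1 c2 s : sem (PSeq c1 c2) s = sem c2 (sem c1 s).
Proof. by []. Qed.

Lemma sem_if b c s : sem (PIf b c) s = if beval s b then sem c s else s.
Proof. by []. Qed.

Definition same_outside (ns rs : seq nat) (s s' : store R) : Prop :=
  (forall a, a \notin ns -> nmem s' a = nmem s a) /\
  (forall a, a \notin rs -> rmem s' a = rmem s a).

Lemma same_outside_trans ns rs s1 s2 s3 :
  same_outside ns rs s1 s2 -> same_outside ns rs s2 s3 ->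
  same_outside ns rs s1 s3.
Proof.
by move=> [n12 r12] [n23 r23]; split=> a ha; rewrite ?n23 ?r23 // ?n12 ?r12.
Qed.

Lemma same_outside_sub ns ns' rs rs' s s' :
  {subset ns <= ns'} -> {subset rs <= rs'} ->
  same_outside ns rs s s' -> same_outside ns' rs' s s'.
Proof.
move=> sub_n sub_r [eq_n eq_r].
by split=> a ha; [apply: eq_n|apply: eq_r]; apply: contra ha; auto.
Qed.

Lemma update_neq (A : Type) (f : nat -> seq nat -> A) a ix x a' :
  a' != a -> update f a ix x a' = f a'.
Proof. by move=> /negPf neq; apply/funext => ix'; rewrite /update neq. Qed.

Lemma nmem_nset s a ix x a' : a' != a -> nmem (nset s a ix x) a' = nmem s a'.
Proof. exact: update_neq. Qed.

Lemma nset_outside s a ix x : same_outside [:: a] [::] s (nset s a ix x).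
Proof. by split=> // b; rewrite inE => neq; apply: update_neq. Qed.

Lemma sem_outside c s : same_outside (nwrites c) (rwrites c) s (sem c s).
Proof.
elim: c s => [a ix e|a ix e|a b|c1 IH1 c2 IH2|b c IH|x b c IH] s /=.
- exact: nset_outside.
- by split=> // b; rewrite inE => neq; apply: update_neq.
- split=> // d; rewrite inE => /negPf neq.
  by apply/funext => ix /=; rewrite neq.
- apply: (@same_outside_trans _ _ _ (sem c1 s)).
    by apply: same_outside_sub (IH1 s) => a; rewrite mem_cat => ->.
  by apply: same_outside_sub (IH2 _) => a; rewrite mem_cat => ->; rewrite orbT.
- by case: ifP.
- have set_x s' v : same_outside (x :: nwrites c) (rwrites c) s' (nset s' x [::] v).
    by apply: same_outside_sub (nset_outside _ _ _ _) => a;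
      rewrite ?inE // => ->.
  elim: (nmem s b [::]) => [|i IHi] /=; first exact: set_x.
  apply: same_outside_trans IHi _; apply: same_outside_trans (set_x _ _).
  by apply: same_outside_sub (IH _) => a //; rewrite inE => ->; rewrite orbT.
Qed.

Lemma sem_nmem c s a : a \notin nwrites c -> nmem (sem c s) a = nmem s a.
Proof. exact: (sem_outside c s).1. Qed.

Lemma sem_rmem c s a : a \notin rwrites c -> rmem (sem c s) a = rmem s a.
Proof. exact: (sem_outside c s).2. Qed.

Lemma well_formed_input c b : well_formed c -> (b <= 1)%N -> b \notin nwrites c.
Proof.
elim: c => [a ix e|a ix e|a d|c1 IH1 c2 IH2|d c IH|x d c IH] //=.
- by rewrite inE => a1 b1; apply: contraTneq a1 => <-; rewrite -leqNgt.
- by rewrite inE => a1 b1; apply: contraTneq a1 => <-; rewrite -leqNgt.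
- by move=> /andP[w1 w2] b1; rewrite mem_cat negb_or IH1 ?IH2.
- move=> /and4P[x1 _ _ wc] b1; rewrite inE negb_or IH // andbT.
  by apply: contraTneq x1 => <-; rewrite -leqNgt.
Qed.

(* The invariant [I i] holds at the test of the loop when x[] = i. *)
Lemma sem_for_ind (I : nat -> store R -> Prop) m x b c s :
    nmem s b [::] = m -> x \notin nwrites c ->
    I 0%N (nset s x [::] 0%N) ->
    (forall i s', (i < m)%N ->
       same_outside (nwrites (PFor x b c)) (rwrites (PFor x b c)) s s' ->
       nmem s' x [::] = i -> I i s' -> I i.+1 (nset (sem c s') x [::] i.+1)) ->
  I m (sem (PFor x b c) s).
Proof.
move=> /= -> xc I0 IS.
pose st i := iteri i (fun i s => nset (sem c s) x [::] i.+1) (nset s x [::] 0%N).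
have set_x s' v :
    same_outside (x :: nwrites c) (rwrites c) s' (nset s' x [::] v).
  by apply: same_outside_sub (nset_outside _ _ _ _) => a;
    rewrite ?inE // => ->.
suff : forall i, (i <= m)%N ->
    [/\ I i (st i), nmem (st i) x [::] = i
      & same_outside (x :: nwrites c) (rwrites c) s (st i)].
  by move=> /(_ _ (leqnn _))[].
elim=> [_|i IHi ltim]; first by split; rewrite //= /update !eqxx.
have [Ii xi fri] := IHi (ltnW ltim).
split=> /=; [exact: IS | by rewrite /update !eqxx |].
apply: same_outside_trans fri _; apply: same_outside_trans (set_x _ _).
by apply: same_outside_sub (sem_outside _ _) => a //; rewrite inE => ->; rewrite orbT.
Qed.

Lemma step_nset a ix e cs (s : store R) r :
  step O (Config (NSet a ix e :: cs) s r) =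
  Config cs (nset s a (map (neval (nmem s)) ix) (neval (nmem s) e)) r.
Proof. by case: s. Qed.

Lemma step_seq c1 c2 cs (s : store R) r :
  step O (Config (Seq c1 c2 :: cs) s r) = Config (c1 :: c2 :: cs) s r.
Proof. by case: s. Qed.

Lemma step_if b c1 c2 cs (s : store R) r :
  step O (Config (If b c1 c2 :: cs) s r) =
  Config ((if beval s b then c1 else c2) :: cs) s r.
Proof. by case: s. Qed.

Lemma step_while b c cs (s : store R) r :
  step O (Config (While b c :: cs) s r) =
  Config (if beval s b then c :: While b c :: cs else cs) s r.
Proof. by case: s. Qed.

(** The step count [t] depends neither on the pending commands nor on the coins, which lets runs be
    chained. *)
Lemma compile_run N c s : well_formed c ->
    (nmem s 0%N [::] <= N)%N -> (nmem s 1%N [::] <= N)%N ->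
  exists2 t, (t <= (time_bound c).[N])%N &
    forall cs r, iter t (step O) (Config (compile c :: cs) s r) =
                 Config cs (sem c s) r.
Proof.
elim: c s => [a ix e|a ix e|a b|c1 IH1 c2 IH2|b c IH|x b c IH] s /= wf n0 n1.
- by exists 1%N; rewrite ?hornerC //; case: s {n0 n1}.
- by exists 1%N; rewrite ?hornerC //; case: s {n0 n1}.
- by exists 1%N; rewrite ?hornerC //; case: s {n0 n1}.
- case/andP: wf => w1 w2.
  have [t1 le1 run1] := IH1 s w1 n0 n1.
  have [|| t2 le2 run2] := IH2 (sem c1 s) w2; rewrite ?sem_nmem ?well_formed_input //.
  exists (t2 + t1.+1)%N; first by rewrite !hornerE /=; lia.
  by move=> cs r; rewrite iterD iterSr step_seq run1 run2.
- have [t le_t run_t] := IH s wf n0 n1.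
  have [bs|bs] := boolP (beval s b).
    exists t.+1; first by rewrite !hornerE /=; lia.
    by move=> cs r; rewrite iterSr step_if bs run_t.
  exists 2%N; first by rewrite !hornerE /=; lia.
  by move=> cs r; rewrite iterSr step_if (negPf bs); case: (s).
case/and4P: wf => x1 b1 xc wc.
pose st i := iteri i (fun i s => nset (sem c s) x [::] i.+1) (nset s x [::] 0%N).
have xb : x != b by apply: contraTneq x1 => ->; rewrite -leqNgt.
have x_st i : nmem (st i) x [::] = i.
  by case: i => [|i]; rewrite /= /update !eqxx.
have in_st i d : (d <= 1)%N -> nmem (st i) d = nmem s d.
  move=> d1; have dx : d != x by apply: contraTneq x1 => <-; rewrite -leqNgt.
  elim: i => [|i IHi] /=; rewrite update_neq //.
  by rewrite sem_nmem // well_formed_input.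
pose loop := While (NLe (NAdd (NGet x [::]) (NConst 1)) (NGet b [::]))
           (Seq (compile c) (NSet x [::] (NAdd (NGet x [::]) (NConst 1)))).
have guard i : beval (st i) (NLe (NAdd (NGet x [::]) (NConst 1)) (NGet b [::]))
    = (i < nmem s b [::])%N.
  by rewrite /= x_st in_st // addn1.
have iterations i : (i <= nmem s b [::])%N ->
    exists2 t, (t <= i * ((time_bound c).[N] + 3))%N &
    forall cs r, iter t (step O) (Config (loop :: cs) (st 0%N) r) =
                 Config (loop :: cs) (st i) r.
  elim: i => [_|i IHi ltib]; first by exists 0%N.
  have [t le_t run_t] := IHi (ltnW ltib).
  have [|| u le_u run_u] := IH (st i) wc; rewrite ?in_st //.
  exists (u + t.+2).+1; first by rewrite mulSn; move: le_t le_u; lia.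
  move=> cs r; rewrite iterS iterD 2!iterS run_t step_while guard ltib step_seq.
  by rewrite run_u step_nset /= sem_nmem // x_st addn1.
have [t le_t run_t] := iterations _ (leqnn _).
have le_bN : (nmem s b [::] <= N)%N.
  by case: b b1 {xb loop guard iterations le_t run_t} => [|[]].
exists (t.+2).+1.
  rewrite !(hornerD, hornerM, hornerX, hornerC) -addn3.
  apply: (@leq_add _ 3 _ 3) => //; apply: leq_trans le_t _.
  exact: leq_mul.
move=> cs r; rewrite iterS 2!iterSr step_seq step_nset run_t.
by rewrite step_while guard ltnn.
Qed.

End Semantics.

(** * Spanners and their encodings *)

Section Spanners.
Variables (R : realType) (n : nat) (G : wgraph R n).

Lemma dist_anti (F F' : {set {set 'I_n}}) u v :
  F \subset F' -> (dist G F' u v <= dist G F u v)%E.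
Proof.
move=> sFF'; apply: le_ereal_inf => _ [p [pF pv] <-].
by exists p => //; split=> //; apply: sub_path pF => x y xy; apply: (subsetP sFF'); exact: xy.
Qed.

(** Dropping terminals removes constraints, and adding edges only shortens distances. *)
Lemma spannerS req (X Y : {set 'I_n}) H H' :
    subsetwise_spanner G req X H -> Y \subset X -> is_subgraph G H' ->
    sg_vertices H \subset sg_vertices H' -> sg_edges H \subset sg_edges H' ->
  subsetwise_spanner G req Y H'.
Proof.
move=> [_ XV HX] sYX subH' sV sE; split=> // [|u v uY vY].
  exact: subset_trans (subset_trans sYX XV) sV.
have := HX u v (subsetP sYX u uY) (subsetP sYX v vY).
by case: req {HX} => a /=; apply: le_trans; apply: dist_anti.
Qed.

Lemma weight_ge0 H : is_subgraph G H -> 0 <= weight G H.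
Proof.
by move=> [sE _]; apply: sumr_ge0 => e eH; apply/ltW/wt_gt0/(subsetP sE).
Qed.

Lemma weight_setU V H H' : sg_edges H \subset edges G ->
  weight G (Subgraph V (sg_edges H :|: sg_edges H')) <=
  weight G H + weight G H'.
Proof.
move=> sH; rewrite /weight /= [leLHS](big_setID (sg_edges H')) /= addrC lerD //.
  rewrite setDUl setDv setU0 [leRHS](big_setID (sg_edges H')) /= lerDr sumr_ge0 //.
  by move=> e /setIP[eH _]; apply/ltW/wt_gt0/(subsetP sH).
by rewrite (setIidPr (subsetUr _ _)).
Qed.

(** An edge has two distinct endpoints, hence arises from exactly two ordered pairs. *)
Lemma sum_edge_pairs (F : {set {set 'I_n}}) : F \subset edges G ->
  \sum_u \sum_v (if [set u; v] \in F then wt G [set u; v] else 0) =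
  (\sum_(e in F) wt G e) *+ 2.
Proof.
move=> sF; rewrite pair_big /= -big_mkcond /=.
rewrite (partition_big (fun uv => [set uv.1; uv.2]) (mem F)) //= -sumrMnl.
apply: eq_bigr => e eF.
have /cards2P[x [y [xy eE]]] : #|e| == 2%N.
  by rewrite (@edges_card2 _ _ G) ?(subsetP sF).
rewrite (eq_bigr (fun=> wt G e)) => [|i /andP[_ /eqP ->]] //.
rewrite sumr_const; congr (_ *+ _).
rewrite (_ : #|_| = #|[set (x, y); (y, x)]|); last first.
  apply: eq_card => -[u v]; rewrite !inE !xpair_eqE unfold_in /=.
  apply/andP/idP => [[_ /eqP euv]|].
    have := set21 x y; have := set22 x y; rewrite -eE -euv !inE.
    by move=> /orP[]/eqP yE /orP[]/eqP xE; move: xy;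
      rewrite yE xE !eqxx ?orbT.
  by case/orP => /andP[/eqP -> /eqP ->]; rewrite ?[[set y; x]]setUC -eE eqxx eF.
by rewrite cards2 xpair_eqE negb_and xy.
Qed.

End Spanners.

Section Encoding.
Variable n : nat.

Lemma vertex_bitE (X : {set 'I_n}) (v : 'I_n) :
  vertex_bit X v = (v \in X) :> nat.
Proof. by rewrite /vertex_bit valK. Qed.

Lemma edge_bitE (F : {set {set 'I_n}}) (u v : 'I_n) :
  edge_bit F u v = ([set u; v] \in F) :> nat.
Proof. by rewrite /edge_bit !valK. Qed.

Lemma decode_verticesE (f : nat -> nat) (X : {set 'I_n}) :
  (forall v : 'I_n, (f v != 0%N) = (v \in X)) -> decode_vertices n f = X.
Proof. by move=> fX; apply/setP => v; rewrite inE fX. Qed.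

Lemma eq_decode_vertices (f g : nat -> nat) :
  (forall v, (v < n)%N -> f v = g v) ->
  decode_vertices n f = decode_vertices n g.
Proof. by move=> fg; apply/setP => v; rewrite !inE fg. Qed.

Lemma eq_decode_edges (f g : nat -> nat -> nat) :
  (forall u v, (u < n)%N -> (v < n)%N -> f u v = g u v) ->
  decode_edges n f = decode_edges n g.
Proof.
move=> fg; apply/setP => e; rewrite !inE.
by apply: eq_existsb => u; apply: eq_existsb => v; rewrite fg.
Qed.

(** Any nonzero entry counts as membership, so the program can form unions by addition. *)
Lemma decode_verticesD (f g : nat -> nat) :
  decode_vertices n (fun v => f v + g v)%N =
  decode_vertices n f :|: decode_vertices n g.
Proof. by apply/setP => v; rewrite !inE addn_eq0 negb_and. Qed.

Lemma decode_edgesD (f g : nat -> nat -> nat) :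
  decode_edges n (fun u v => f u v + g u v)%N =
  decode_edges n f :|: decode_edges n g.
Proof.
apply/setP => e; rewrite !inE; apply/existsP/orP => [[u /existsP[v]]|].
  rewrite addn_eq0 negb_and => /andP[/orP[fuv|guv] euv]; [left|right];
    by apply/existsP; exists u; apply/existsP; exists v; apply/andP.
by case=> /existsP[u /existsP[v /andP[fuv euv]]]; exists u; apply/existsP;
  exists v; rewrite addn_eq0 negb_and fuv ?orbT.
Qed.

Lemma decode_edge_bit (F : {set {set 'I_n}}) :
  (forall e, e \in F -> #|e| = 2%N) -> decode_edges n (edge_bit F) = F.
Proof.
move=> F2; apply/setP => e; rewrite inE; apply/existsP/idP => [[u]|eF].
  by move=> /existsP[v]; rewrite edge_bitE eqb0 negbK => /andP[? /eqP ->].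
have /eqP/cards2P[x [y [_ eE]]] := F2 e eF.
by exists x; apply/existsP; exists y; rewrite edge_bitE -eE eF eqxx.
Qed.

Lemma decode_vertex_bit (X : {set 'I_n}) : decode_vertices n (vertex_bit X) = X.
Proof. by apply: decode_verticesE => v; rewrite vertex_bitE eqb0 negbK. Qed.

End Encoding.

(** * The dynamic program *)

(* Naturals: [aN], [aK], [aS], [aV], [aE] are the prescribed inputs and outputs,
   [aX] and [aA] the oracle's question and answer.  [rSum] is twice the weight
   of the current answer, since its edges are summed over ordered pairs;
   [rCost[p]] is twice the optimal cost of the levels >= p when a group starts
   at p, and [aNext[p]] is the level where the next group then starts. *)
Local Notation aN := 0%N (only parsing).
Local Notation aK := 1%N (only parsing).
Local Notation aS := 3%N (only parsing).
Local Notation aV := 4%N (only parsing).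
Local Notation aE := 5%N (only parsing).
Local Notation aX := 6%N (only parsing).
Local Notation aA := 7%N (only parsing).
Local Notation aNext := 8%N (only parsing).
Local Notation ax := 9%N (only parsing).
Local Notation ap := 10%N.
Local Notation aq := 11%N.
Local Notation ai := 12%N.
Local Notation au := 13%N.
Local Notation av := 14%N.
Local Notation rW := 0%N (only parsing).
Local Notation rCost := 1%N (only parsing).
Local Notation rSum := 2%N (only parsing).
Local Notation rAcc := 3%N (only parsing).
Local Notation "$ a" := (NGet a [::]) (at level 2, a at level 1, format "$ a").
Local Notation "e1 ;; e2" := (PSeq e1 e2) (at level 60, right associativity).

Definition ask : prog :=
  PFor av aN (PSet aX [:: $av] (NGet aS [:: $ap; $av])) ;;
  PQuery aX aA.

Definition weigh : prog :=
  PRSet rSum [::] RZero ;;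
  PFor au aN (PFor av aN
    (PIf (NLe (NConst 1) (NGet aA [:: $au; $av]))
       (PRSet rSum [::] (RAdd (RGet rSum [::]) (RGet rW [:: $au; $av]))))).

(** Repeated addition into [rAcc] replaces multiplication: at iteration i it holds i + 1 times the
    weight, the charge for a group ending before level q = i + 1. The loop starts at 0 because this
    charge includes the levels below p. At i = p the candidate is stored without comparison, since
    [rCost[p]] has no meaningful value yet. *)
Definition relax : prog :=
  let candidate :=
    RAdd (RGet rAcc [::]) (RGet rCost [:: NAdd $ai (NConst 1)]) in
  PRSet rAcc [::] RZero ;;
  PFor ai aK
    (PRSet rAcc [::] (RAdd (RGet rAcc [::]) (RGet rSum [::])) ;;
     PIf (BAnd (NLe $ap $ai)
            (BNot (BAnd (BNot (NLe $ai $ap))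
                        (BNot (RLe candidate (RGet rCost [:: $ap]))))))
       (PRSet rCost [:: $ap] candidate ;;
        PSet aNext [:: $ap] (NAdd $ai (NConst 1)))).

(** Levels are treated from k - 1 down to 0, as each cost refers to higher starts; the base value
    [rCost[k]] is the initial 0. *)
Definition plan : prog :=
  PFor ax aK
    (PSet ap [::] (NSub (NSub $aK (NConst 1)) $ax) ;; ask ;; weigh ;; relax).

Definition merge_row : prog :=
  PFor av aN
    (PSet aE [:: $ai; $au; $av]
       (NAdd (NGet aE [:: $ai; $au; $av]) (NGet aA [:: $au; $av]))).

Definition merge_level : prog :=
  PFor au aN
    (PSet aV [:: $ai; $au] (NAdd (NGet aV [:: $ai; $au]) (NGet aA [:: $au])) ;;
     merge_row).

(** The answer goes to all levels below q, including those of earlier groups; this keeps the edge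
    sets nested. *)
Definition merge : prog :=
  PFor ai aK (PIf (NLe (NAdd $ai (NConst 1)) $aq) merge_level).

(** A bounded loop simulates following the cuts: p never falls behind the counter, so the test
    succeeds exactly when the counter reaches the start of the next group. *)
Definition build : prog :=
  PSet ap [::] (NConst 0) ;;
  PFor ax aK
    (PIf (NLe $ap $ax)
       (ask ;; PSet aq [::] (NGet aNext [:: $ap]) ;; merge ;;
        PSet ap [::] $aq)).

Definition multilevel_prog : prog := plan ;; build.

(** * Correctness of the dynamic program *)

Section Correctness.
Variables (R : realType) (req : requirement R) (n k : nat) (G : wgraph R n).
Variables (S : 'I_k -> {set 'I_n}) (O : {set 'I_n} -> subgraph n).
Hypothesis S_nested : nested_terminals S.
Hypothesis O_min : min_spanner_oracle G req O.

Local Notation sem := (sem O).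

(** The empty set for p >= k matches the zero entries of the input array out of range. *)
Definition spanner_at (p : nat) : subgraph n :=
  O (if insub p is Some i then S i else set0).

Definition weight_at (p : nat) : R := weight G (spanner_at p).

Definition has_input (s : store R) : Prop :=
  [/\ nmem s aN [::] = n, nmem s aK [::] = k,
      nmem s aS = input_nmem G S aS & rmem s rW = input_rmem G rW].

Lemma has_input_outside ns rs s s' :
    same_outside ns rs s s' ->
    [&& aN \notin ns, aK \notin ns, aS \notin ns & rW \notin rs] ->
  has_input s -> has_input s'.
Proof.
by move=> [eq_n eq_r] /and4P[? ? ? ?] [? ? ? ?]; split; rewrite ?eq_n ?eq_r.
Qed.

Lemma sem_ask s : has_input s ->
  nmem (sem ask s) aA = answer (spanner_at (nmem s ap [::])).
Proof.
move=> [sN _ sS _]; set p := nmem s ap [::].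
pose fill := PFor av aN (PSet aX [:: $av] (NGet aS [:: $ap; $av])).
have fillP : forall v, (v < n)%N ->
    nmem (sem fill s) aX [:: v] = nmem s aS [:: p; v].
  pose I j (s' : store R) := forall v, (v < j)%N ->
    nmem s' aX [:: v] = nmem s aS [:: p; v].
  apply: (sem_for_ind (I := I)) => // j s' jn fr s'v Is' v.
  rewrite ltnS leq_eqVlt /= /update /= !eqseq_cons eqxx !andbT s'v.
  have [->|vj] := eqVneq; first by rewrite !fr.1.
  exact: Is'.
rewrite /ask -/fill.
apply/funext => ix /=; congr (answer (O _) ix).
apply: decode_verticesE => v; rewrite fillP // sS /= /vertex_bit.
by case: insubP => [i _ _|_]; rewrite ?valK ?inE // eqb0 negbK.
Qed.

Lemma sem_weigh s H : has_input s -> nmem s aA = answer H ->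
  sg_edges H \subset edges G ->
  rmem (sem weigh s) rSum [::] = weight G H *+ 2.
Proof.
move=> [sN _ _ sW] sA sH.
pose f u v := if (0 < answer H [:: u; v])%N then input_rmem G rW [:: u; v] else 0.
transitivity (\sum_(0 <= u < n) \sum_(0 <= v < n) f u v); last first.
  rewrite /weight -sum_edge_pairs // big_mkord; apply: eq_bigr => u _.
  rewrite big_mkord; apply: eq_bigr => v _; rewrite /f /= edge_bitE !valK lt0b.
  by case: ifP => // uv; rewrite (subsetP sH).
pose I i (s' : store R) :=
  rmem s' rSum [::] = \sum_(0 <= u < i) \sum_(0 <= v < n) f u v.
suff : I n (sem weigh s) by [].
rewrite /weigh sem_seq.
apply: (sem_for_ind (I := I)) => //; first by rewrite /I /= /update /= big_nil.
move=> i s1 lt_in fr1 s1u Is1.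
pose J j (s' : store R) := rmem s' rSum [::] =
  \sum_(0 <= u < i) \sum_(0 <= v < n) f u v + \sum_(0 <= v < j) f i v.
suff : J n (nset (sem (PFor av aN
    (PIf (NLe (NConst 1) (NGet aA [:: $au; $av]))
       (PRSet rSum [::] (RAdd (RGet rSum [::]) (RGet rW [:: $au; $av])))))
       s1) au [::] i.+1).
  by rewrite /J /I big_nat_recr.
apply: (sem_for_ind (I := J)) => //.
- by rewrite fr1.1.
- by rewrite /J /= big_nil addr0.
move=> j s2 lt_jn fr2 s2v Js2.
have s2A : nmem s2 aA = answer H by rewrite fr2.1 // fr1.1.
have s2W : rmem s2 rW = input_rmem G rW by rewrite fr2.2 // fr1.2.
have s2u : nmem s2 au [::] = i by rewrite fr2.1.
have fE : f i j = if (0 < nmem s2 aA [:: i; j])%N then rmem s2 rW [:: i; j] else 0.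
  by rewrite s2A s2W.
rewrite /J big_nat_recr // [RHS]addrA fE /= s2v s2u.
by case: ifP => _; rewrite /= ?addr0 /update /= Js2.
Qed.

(** Bellman equation at p with the next cut restricted to p < q <= q0; [aNext[p]] attains the
    minimum. *)
Definition optimal_jump (w : R) (s : store R) p q0 : Prop :=
  [/\ (nmem s aNext [:: p] <= q0)%N, (p < nmem s aNext [:: p])%N,
      rmem s rCost [:: p] = (nmem s aNext [:: p])%:R * w +
        rmem s rCost [:: nmem s aNext [:: p]]
    & forall q, (p < q <= q0)%N ->
      rmem s rCost [:: p] <= q%:R * w + rmem s rCost [:: q]].

Lemma sem_relax s p : has_input s -> nmem s ap [::] = p -> (p < k)%N ->
  optimal_jump (rmem s rSum [::]) (sem relax s) p k /\
  forall p', p' != p ->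
    rmem (sem relax s) rCost [:: p'] = rmem s rCost [:: p'] /\
    nmem (sem relax s) aNext [:: p'] = nmem s aNext [:: p'].
Proof.
move=> [_ sK _ _] sp pk.
(* After y iterations the cuts up to y have been tried; the first admissible one is p + 1, hence the
   premise p < y. *)
pose I y (s' : store R) :=
  [/\ rmem s' rAcc [::] = y%:R * rmem s rSum [::],
      (p < y)%N -> optimal_jump (rmem s rSum [::]) s' p y
    & forall p', p' != p -> rmem s' rCost [:: p'] = rmem s rCost [:: p'] /\
        nmem s' aNext [:: p'] = nmem s aNext [:: p']].
suff : I k (sem relax s) by case=> _ /(_ pk).
rewrite /relax sem_seq; apply: (sem_for_ind (I := I)) => //.
  split; first by rewrite /= /update /= mul0r.
    by rewrite ltn0.
  by move=> p' _; rewrite /= /update.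
move=> y s' yk fr s'i [accI jumpI restI].
have s'p : nmem s' ap [::] = p by rewrite fr.1.
have s'sum : rmem s' rSum = rmem s rSum by rewrite fr.2.
set w := rmem s rSum [::] in accI jumpI *.
have accS : rmem s' rAcc [::] + w = y.+1%:R * w by rewrite accI -natr1 mulrDl mul1r.
rewrite /= s'i s'p s'sum addn1 -/w accS [update _ _ _ _ rCost]/(rmem s' rCost).
set cand := _ + rmem s' rCost [:: y.+1].
have [py|yp] := leqP p y; last first.
  split=> //=.
  by rewrite ltnS leqNgt yp.
have yp : y.+1 != p by rewrite gtn_eqF // ltnS.
(* Covers both reasons for writing: the first candidate, and a later one that is no worse than the
   stored cost. *)
have jump_update : (forall q, (p < q <= y)%N -> cand <= q%:R * w + rmem s' rCost [:: q]) ->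
    I y.+1 (nset (nset (rset (rset s' rAcc [::] (y.+1%:R * w)) rCost [:: p] cand)
      aNext [:: p] y.+1) ai [::] y.+1).
  move=> cand_le; split=> [|_|p' p'p].
  - by rewrite /= /update /=.
  - split; rewrite /= /update /= !eqxx //=.
      by rewrite eqseq_cons (negPf yp).
    move=> q /andP[pq]; rewrite leq_eqVlt eqseq_cons (gtn_eqF pq) /= => /orP[/eqP -> //|qy].
    by apply: cand_le; rewrite pq.
  - by rewrite /= /update /= eqseq_cons (negPf p'p) /=; apply: restI.
have [yp'|{}yp'] := leqP y p => /=.
  by apply: jump_update => q /andP[pq /leq_trans/(_ yp')]; rewrite leqNgt pq.
have [next_le lt_next costE cost_le] := jumpI yp'.
rewrite negbK; case: ifP => [le_cand|/negbT].
  by apply: jump_update => q /cost_le; apply: le_trans.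
rewrite -ltNge => /ltW lt_cand; split=> [|_|p' p'p].
- by rewrite /= /update /=.
- split; rewrite /= /update /=; [exact: leqW|exact: lt_next|exact: costE|].
  move=> q /andP[pq]; rewrite leq_eqVlt => /orP[/eqP -> //|qy].
  by apply: cost_le; rewrite pq.
- by rewrite /= /update /=; apply: restI.
Qed.

(** The equation at p reads only entries from p on, so it survives the later passes of [plan], which
    write at smaller indices. *)
Lemma eq_optimal_jump w s s' p q0 :
    (forall q, (p <= q)%N -> rmem s' rCost [:: q] = rmem s rCost [:: q] /\
       nmem s' aNext [:: q] = nmem s aNext [:: q]) ->
  optimal_jump w s p q0 -> optimal_jump w s' p q0.
Proof.
move=> eq_ss [le_next lt_next costE cost_le].
have [cost_p next_p] := eq_ss p (leqnn p).
split; rewrite ?next_p ?cost_p //.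
  by rewrite costE (eq_ss _ (ltnW lt_next)).1.
move=> q pq; have /andP[/ltnW/eq_ss[-> _] _] := pq; exact: cost_le.
Qed.

Lemma spanner_at_min p : subsetwise_spanner G req
  (if insub p is Some i then S i else set0) (spanner_at p).
Proof. by case: (O_min (if insub p is Some i then S i else set0)). Qed.

Lemma spanner_at_subgraph p : is_subgraph G (spanner_at p).
Proof. by case: (spanner_at_min p). Qed.

Lemma sem_plan s : has_input s -> rmem s rCost [:: k] = 0 ->
  rmem (sem plan s) rCost [:: k] = 0 /\
  forall p, (p < k)%N -> optimal_jump (weight_at p *+ 2) (sem plan s) p k.
Proof.
move=> s_in cost_k; have [_ sK _ _] := s_in.
pose I x (s' : store R) := rmem s' rCost [:: k] = 0 /\
  forall p, (k - x <= p < k)%N -> optimal_jump (weight_at p *+ 2) s' p k.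
suff : I k (sem plan s).
  by case=> ? jump; split=> // p pk; apply: jump; rewrite subnn.
apply: (sem_for_ind (I := I)) => //.
  by split=> // p /andP[]; rewrite subn0 ltnNge => ->.
move=> x s' xk fr s'x [cost'_k jump].
have s'_in := has_input_outside fr isT s_in.
set p := (k - 1 - x)%N.
have pk : (p < k)%N by rewrite /p; lia.
rewrite !sem_seq.
set s1 := sem (PSet _ _ _) s'; pose s2 := sem ask s1; pose s3 := sem weigh s2.
have s1p : nmem s1 ap [::] = p.
  by rewrite /= /update /= s'x; have [_ -> _ _] := s'_in.
have s1_in : has_input s1 by [].
have s2_in : has_input s2 := has_input_outside (sem_outside O ask s1) isT s1_in.
have s3_in : has_input s3 := has_input_outside (sem_outside O weigh s2) isT s2_in.
have s3sum : rmem s3 rSum [::] = weight_at p *+ 2.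
  rewrite /s3 (sem_weigh (H := spanner_at p)) //; last first.
    by case: (spanner_at_subgraph p).
  by rewrite /s2 sem_ask // s1p.
have s3p : nmem s3 ap [::] = p by rewrite /s3 sem_nmem // sem_nmem.
have [jump_p rest] := sem_relax s3_in s3p pk.
have cost3 : rmem s3 rCost = rmem s' rCost by rewrite /s3 /s2 !sem_rmem.
have next3 : nmem s3 aNext = nmem s' aNext by rewrite /s3 /s2 !sem_nmem.
rewrite s3sum cost3 next3 in jump_p rest.
rewrite -/s3.
split; first by rewrite /= (rest k _).1 // gtn_eqF.
move=> p' /andP[le_p' p'k].
have [->|p'p] := eqVneq p' p; first exact: jump_p.
apply: eq_optimal_jump (jump p' _) => [q p'q|]; last by rewrite p'k andbT; move: p'p; rewrite /p; lia.
by apply: (rest q); move: p'p; rewrite /p; lia.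
Qed.

(** * Assembling the levels from the cuts *)

Lemma sem_merge_row s i u v : has_input s ->
  nmem (sem merge_row s) aE [:: i; u; v] = (nmem s aE [:: i; u; v] +
    [&& i == nmem s ai [::], u == nmem s au [::] & v < n] *
      nmem s aA [:: u; v])%N.
Proof.
move=> [sN _ _ _].
pose I j (s' : store R) := nmem s' aE [:: i; u; v] = (nmem s aE [:: i; u; v] +
    [&& i == nmem s ai [::], u == nmem s au [::] & v < j] *
      nmem s aA [:: u; v])%N.
apply: (sem_for_ind (I := I)) => //; first by rewrite /I ltn0 !andbF mul0n addn0.
move=> j s' jn fr s'v Is'.
rewrite /I /= /update /= s'v !eqseq_cons eqxx andbT.
rewrite [nmem s' ai]fr.1 // [nmem s' au]fr.1 // [nmem s' aA]fr.1 //.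
rewrite ltnS leq_eqVlt; move: Is'; rewrite /I.
have [->|_] := eqVneq i; have [->|_] := eqVneq u; have [->|_] := eqVneq v => //=.
by rewrite ltnn mul0n addn0 => ->; rewrite mul1n.
Qed.

Lemma sem_merge_level s i : has_input s ->
  (forall u, nmem (sem merge_level s) aV [:: i; u] = (nmem s aV [:: i; u] +
     ((i == nmem s ai [::]) && (u < n)) * nmem s aA [:: u])%N) /\
  (forall u v, nmem (sem merge_level s) aE [:: i; u; v] =
     (nmem s aE [:: i; u; v] +
     [&& i == nmem s ai [::], u < n & v < n] * nmem s aA [:: u; v])%N).
Proof.
move=> s_in; have [sN _ _ _] := s_in.
pose I l (s' : store R) :=
  (forall u, nmem s' aV [:: i; u] = (nmem s aV [:: i; u] +
     ((i == nmem s ai [::]) && (u < l)) * nmem s aA [:: u])%N) /\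
  (forall u v, nmem s' aE [:: i; u; v] = (nmem s aE [:: i; u; v] +
     [&& i == nmem s ai [::], u < l & v < n] * nmem s aA [:: u; v])%N).
apply: (sem_for_ind (I := I)) => //.
  by split=> [u|u v]; rewrite ltn0 andbF mul0n addn0.
move=> l s' ln fr s'u [IV IE].
have s'_in := has_input_outside fr isT s_in.
rewrite sem_seq; set s1 := sem _ s'.
have s1_in : has_input s1 by [].
split=> [u|u v].
- rewrite nmem_nset // sem_nmem // /s1 /= /update /= s'u !eqseq_cons !andbT.
  rewrite [nmem s' ai]fr.1 // [nmem s' aA]fr.1 // ltnS leq_eqVlt.
  move: (IV u); have [->|_] := eqVneq i; have [->|_] := eqVneq u => //=.
  by rewrite ltnn mul0n addn0 mul1n => ->.
- have s1A : nmem s1 aA = nmem s aA by rewrite -(fr.1 aA).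
  have s1i : nmem s1 ai = nmem s ai by rewrite -(fr.1 ai).
  have s1u : nmem s1 au [::] = l by rewrite -s'u.
  have s1E : nmem s1 aE = nmem s' aE by [].
  rewrite nmem_nset // sem_merge_row // s1A s1i s1u s1E IE.
  rewrite [(u < l.+1)%N]ltnS [(u <= l)%N]leq_eqVlt.
  have [_|_] := eqVneq i; have [->|_] := eqVneq u => //=.
  all: by rewrite ?ltnn ?mul0n ?addn0.
Qed.

Lemma sem_merge s i : has_input s -> (i < k)%N ->
  (forall u, (u < n)%N -> nmem (sem merge s) aV [:: i; u] =
     (nmem s aV [:: i; u] + (i < nmem s aq [::]) * nmem s aA [:: u])%N) /\
  (forall u v, (u < n)%N -> (v < n)%N -> nmem (sem merge s) aE [:: i; u; v] =
     (nmem s aE [:: i; u; v] +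
      (i < nmem s aq [::]) * nmem s aA [:: u; v])%N).
Proof.
move=> s_in ik; have [_ sK _ _] := s_in.
pose I l (s' : store R) :=
  (forall u, (u < n)%N -> nmem s' aV [:: i; u] = (nmem s aV [:: i; u] +
     ((i < l) && (i < nmem s aq [::])) * nmem s aA [:: u])%N) /\
  (forall u v, (u < n)%N -> (v < n)%N -> nmem s' aE [:: i; u; v] =
     (nmem s aE [:: i; u; v] +
     ((i < l) && (i < nmem s aq [::])) * nmem s aA [:: u; v])%N).
suff : I k (sem merge s) by rewrite /I ik.
apply: (sem_for_ind (I := I)) => //.
  by split=> *; rewrite ltn0 mul0n addn0.
move=> l s' lk fr s'i [IV IE].
have s'_in := has_input_outside fr isT s_in.
have s'A : nmem s' aA = nmem s aA by rewrite fr.1.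
have [LV LE] := sem_merge_level i s'_in.
rewrite s'A s'i in LV LE.
rewrite sem_if; set b := beval _ _.
have -> : b = (l < nmem s aq [::])%N by rewrite /b /= s'i addn1 fr.1.
move: (sem merge_level s') LV LE => s2 LV LE.
rewrite /I [(i < l.+1)%N]ltnS [(i <= l)%N]leq_eqVlt.
split=> [u un|u v un vn]; rewrite nmem_nset //.
- have := IV u un; have := LV u; rewrite un.
  by have [->|_] := eqVneq i l; rewrite ?ltnn /=; case: (l < _)%N => /= s2E s'E;
    rewrite ?s2E s'E ?addn0 ?addn0.
- have := IE u v un vn; have := LE u v; rewrite un vn.
  by have [->|_] := eqVneq i l; rewrite ?ltnn /=; case: (l < _)%N => /= s2E s'E;
    rewrite ?s2E s'E ?addn0 ?addn0.
Qed.

Definition built (s : store R) (i : nat) : subgraph n :=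
  Subgraph (decode_vertices n (fun v => nmem s aV [:: i; v]))
    (decode_edges n (fun u v => nmem s aE [:: i; u; v])).

Lemma eq_built s s' i : nmem s' aV = nmem s aV -> nmem s' aE = nmem s aE ->
  built s' i = built s i.
Proof. by rewrite /built => -> ->. Qed.

Lemma built_merge s H i : has_input s -> (i < k)%N -> is_subgraph G H ->
    nmem s aA = answer H ->
  built (sem merge s) i =
    if (i < nmem s aq [::])%N then
      Subgraph (sg_vertices (built s i) :|: sg_vertices H)
               (sg_edges (built s i) :|: sg_edges H)
    else built s i.
Proof.
move=> s_in ik [sH _] sA; have [mV mE] := sem_merge s_in ik.
rewrite /built (eq_decode_vertices mV) (eq_decode_edges mE) sA.
case: ifP => _ /=; last first.
  congr Subgraph; first by apply: eq_decode_vertices => v _; rewrite addn0.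
  by apply: eq_decode_edges => u v _ _; rewrite addn0.
congr Subgraph.
  rewrite -[in RHS](decode_vertex_bit (sg_vertices H)) -decode_verticesD.
  by apply: eq_decode_vertices => v _; rewrite mul1n.
rewrite -[in RHS](decode_edge_bit (F := sg_edges H)).
  rewrite -decode_edgesD.
  by apply: eq_decode_edges => u v _ _; rewrite mul1n.
by move=> e eH; rewrite (@edges_card2 _ _ G) // (subsetP sH).
Qed.

Lemma is_subgraph_setU H H' : is_subgraph G H -> is_subgraph G H' ->
  is_subgraph G (Subgraph (sg_vertices H :|: sg_vertices H')
                          (sg_edges H :|: sg_edges H')).
Proof.
move=> [sH eH] [sH' eH']; split=> [|e] /=; first by rewrite subUset sH.
rewrite inE => /orP[/eH|/eH'] /subset_trans; apply.
  exact: subsetUl.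
exact: subsetUr.
Qed.

(** Containing the answer for a level j <= i suffices for feasibility at level i, because the
    terminals of level j include those of level i. *)
Definition covered (H : subgraph n) (i : nat) : Prop :=
  exists2 j, (j <= i)%N &
    sg_vertices (spanner_at j) \subset sg_vertices H /\
    sg_edges (spanner_at j) \subset sg_edges H.

Lemma sem_build s : has_input s ->
    nmem s aV = (fun=> 0%N) -> nmem s aE = (fun=> 0%N) ->
    rmem s rCost [:: k] = 0 ->
    (forall p, (p < k)%N -> optimal_jump (weight_at p *+ 2) s p k) ->
    let H := built (sem build s) in
  [/\ forall i, (i < k)%N -> covered (H i) i,
      forall i, (i < k)%N -> is_subgraph G (H i),
      forall i j, (i <= j < k)%N -> sg_edges (H j) \subset sg_edges (H i)
    & (\sum_(0 <= i < k) weight G (H i)) *+ 2 <= rmem s rCost [:: 0%N]].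
Proof.
move=> s_in V0 E0 cost_k jumps; have [_ sK _ _] := s_in.
(* The weight already spent plus the cost-to-go at p never exceeds the planned cost at 0; both are
   doubled as in [rCost]. *)
pose J p (H : nat -> subgraph n) :=
  [/\ forall i, (i < p)%N -> covered (H i) i,
      forall i, (i < k)%N -> is_subgraph G (H i),
      forall i j, (i <= j < k)%N -> sg_edges (H j) \subset sg_edges (H i)
    & (\sum_(0 <= i < k) weight G (H i)) *+ 2 + rmem s rCost [:: p]
        <= rmem s rCost [:: 0%N]].
pose I x (s' : store R) :=
  (x <= nmem s' ap [::] <= k)%N /\ J (nmem s' ap [::]) (built s').
suff : I k (sem build s).
  case; rewrite andbC -eqn_leq /J => /eqP ->; rewrite cost_k addr0; exact.
rewrite /build sem_seq; apply: (sem_for_ind (I := I)) => //.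
  split=> //=.
  have H0 i : built s i = Subgraph set0 set0.
    rewrite /built V0 E0; congr Subgraph; apply/setP => e; rewrite !inE //.
    by apply/existsP => -[u /existsP[v]].
  split=> // [i _|i j _|]; rewrite ?[built _ _]H0.
  - by split=> [|e]; rewrite ?sub0set ?inE.
  - exact: sub0set.
  - rewrite big1 ?mul0rn ?add0r // => i _.
    by rewrite [built _ _]H0 /weight big_set0.
move=> x s1 xk fr s1x [/andP[x_le le_k] J1].
have s1_in : has_input s1 by exact: has_input_outside fr isT s_in.
rewrite sem_if; set b := beval _ _.
have -> : b = (nmem s1 ap [::] <= x)%N by rewrite /b /= s1x.
case: ifP => [le_x|/negbT]; last by rewrite -ltnNge => lt_x; split; rewrite ?lt_x.
have s1p : nmem s1 ap [::] = x by apply/eqP; rewrite eqn_leq le_x.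
rewrite s1p in J1 => {x_le le_k le_x b}.
have [le_next lt_next costE _] := jumps x xk.
set q := nmem s aNext [:: x] in le_next lt_next costE.
rewrite sem_seq; pose s2 := sem ask s1; rewrite -/s2 2!sem_seq.
have s2_in : has_input s2 := has_input_outside (sem_outside O ask s1) isT s1_in.
have s2p : nmem s2 ap [::] = x by rewrite sem_nmem.
have s2next : nmem s2 aNext = nmem s aNext by rewrite sem_nmem // fr.1.
have s2A : nmem s2 aA = answer (spanner_at x) by rewrite sem_ask // s1p.
have built2 i : built s2 i = built s1 i by apply: eq_built; rewrite sem_nmem.
clearbody s2; set s3 := sem (PSet aq _ _) s2.
have s3_in : has_input s3 by [].
have s3q : nmem s3 aq [::] = q by rewrite /= /update /= s2p s2next.
have s3A : nmem s3 aA = answer (spanner_at x) by rewrite -s2A.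
have built3 i : built s3 i = built s1 i by rewrite -built2; apply: eq_built.
have subO := spanner_at_subgraph x.
have built4 i : (i < k)%N -> built (sem merge s3) i =
    if (i < q)%N then
      Subgraph (sg_vertices (built s1 i) :|: sg_vertices (spanner_at x))
               (sg_edges (built s1 i) :|: sg_edges (spanner_at x))
    else built s1 i.
  by move=> ik; rewrite (built_merge s3_in ik subO s3A) s3q built3.
have s4q : nmem (sem merge s3) aq [::] = q by rewrite sem_nmem.
move: (sem merge s3) built4 s4q => s4 built4 s4q.
rewrite /I [nmem _ ap [::]](_ : _ = q); last by rewrite /= /update.
split; first by rewrite lt_next.
have -> : built (nset (sem (PSet ap [::] $aq) s4) ax [::] x.+1) = built s4 by [].
have [cov sub nest weight_le] := J1.
split.
- move=> i iq; rewrite built4 ?iq; last exact: leq_trans le_next.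
  have [ix|xi] := ltnP i x.
    have [j ji [sV sE]] := cov i ix.
    by exists j => //; split; apply: subset_trans (subsetUl _ _).
  by exists x => //; split; apply: subsetUr.
- by move=> i ik; rewrite built4 //; case: ifP => _; [apply: is_subgraph_setU|]; auto.
- move=> i j ijk; have /andP[ij jk] := ijk; have ik := leq_ltn_trans ij jk.
  rewrite !built4 //; have := nest i j ijk.
  have [jq|_] := ltnP j q; first by rewrite (leq_ltn_trans ij jq); apply: setSU.
  by case: ifP => // _ /subset_trans; apply; apply: subsetUl.
(* The answer for x is added to q levels, each growing by at most its weight; this is the charge q w
   in the Bellman equation at x. *)
- apply: le_trans weight_le; rewrite costE addrA lerD2r.
  rewrite mulrnAr -mulrnDl lerMn2r /=.
  apply: le_trans (_ : \sum_(0 <= i < k) (weight G (built s1 i) +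
      if (i < q)%N then weight_at x else 0) <= _).
    apply: ler_sum_nat => i /andP[_ ik]; rewrite built4 //.
    case: ifP => _; last by rewrite addr0.
    by apply: weight_setU; case: (sub i ik).
  rewrite big_split /= lerD2l -big_mkcond /=.
  rewrite -(big_nat_widen _ _ _ xpredT (fun=> weight_at x) le_next).
  by rewrite sumr_const_nat subn0 mulr_natl.
Qed.

(** * Comparison with the optimum *)

Lemma weight_at_ge0 p : 0 <= weight_at p.
Proof. exact/weight_ge0/spanner_at_subgraph. Qed.

(** The answer for level i is also feasible for the fewer terminals of level j, where the oracle is
    optimal. *)
Lemma weight_at_anti i j : (i <= j < k)%N -> weight_at j <= weight_at i.
Proof.
move=> /andP[ij jk]; have ik := leq_ltn_trans ij jk.
have [_ min_j] := O_min (if insub j is Some i then S i else set0).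
apply: min_j; have subO := spanner_at_subgraph i.
apply: spannerS (spanner_at_min i) _ subO (subxx _) (subxx _).
by rewrite !insubT; apply: S_nested.
Qed.

(** Each level of a feasible solution is itself a single-level spanner, so the oracle's answer is no
    heavier. *)
Lemma weight_at_le (H : 'I_k -> subgraph n) : multilevel_spanner G req S H ->
  \sum_(0 <= i < k) weight_at i <= total_weight G H.
Proof.
move=> [H_spanner _]; rewrite big_mkord; apply: ler_sum => i _.
rewrite /weight_at /spanner_at valK.
by have [_] := O_min (S i); apply.
Qed.

Definition input_store : store R := Store (input_nmem G S) (input_rmem G).

Definition result_at : nat -> subgraph n := built (sem multilevel_prog input_store).

Lemma result_spanner : multilevel_spanner G req S (fun i : 'I_k => result_at i) /\
  (\sum_(0 <= i < k) weight G (result_at i)) *+ 2 <=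
    expR 1 * (\sum_(0 <= i < k) weight_at i) *+ 2.
Proof.
have s_in : has_input input_store by [].
have [cost_k jumps] := sem_plan s_in (erefl _).
have p_in : has_input (sem plan input_store).
  exact: has_input_outside (sem_outside O plan input_store) isT s_in.
have [||cov sub nest weight_le] := sem_build p_in _ _ cost_k jumps.
- by rewrite sem_nmem //; apply/funext => -[|? []].
- by rewrite sem_nmem //; apply/funext => -[|? []].
split.
  split=> [i|i j ij]; last by apply: nest; rewrite ij /=.
  have [j ji [sV sE]] := cov i (ltn_ord i).
  apply: spannerS (spanner_at_min j) _ (sub i (ltn_ord i)) sV sE.
  by rewrite (insubT (fun i => i < k)%N (leq_ltn_trans ji (ltn_ord i))); apply: S_nested.
apply: le_trans weight_le _.
(* Weights and costs, both doubled, are extended by 0 beyond the last level to fit the averaging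
   argument. *)
pose m i := if (i < k)%N then weight_at i *+ 2 else 0.
pose c p := if (p < k)%N then rmem (sem plan input_store) rCost [:: p] else 0.
have cE p : (p <= k)%N -> rmem (sem plan input_store) rCost [:: p] = c p.
  by rewrite /c leq_eqVlt => /orP[/eqP ->|->//]; rewrite ltnn.
have m_ge0 i : 0 <= m i.
  by rewrite /m; case: ifP => // _; rewrite mulrn_wge0 ?weight_at_ge0.
have m_anti i j : (i <= j)%N -> m j <= m i.
  move=> ij; rewrite {1}/m; case: ifP => // jk.
  by rewrite /m (leq_ltn_trans ij jk) lerMn2r weight_at_anti ?ij.
have m_eq0 i : (k <= i)%N -> m i = 0 by rewrite leqNgt /m => /negPf ->.
have c_eq0 i : (k <= i)%N -> c i = 0 by rewrite leqNgt /c => /negPf ->.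
have c_jump p q : (p <= q)%N -> c p <= q%:R * m p + c q.
  rewrite leq_eqVlt => /orP[/eqP ->|pq]; first by rewrite lerDr mulr_ge0.
  have [pk|kp] := ltnP p k; last first.
    by rewrite m_eq0 // mulr0 add0r !c_eq0 // (leq_trans kp) // ltnW.
  have mp : m p = weight_at p *+ 2 by rewrite /m pk.
  have [_ _ _ cost_le] := jumps p pk.
  have [qk|kq] := leqP q k.
    by rewrite -!cE ?(ltnW pk) // mp; apply: cost_le; rewrite pq.
  (* A jump past [k] costs at least as much as the jump to [k], and both leave no further cost. *)
  apply: le_trans (_ : k%:R * m p + c k <= _).
    by rewrite -!cE ?(ltnW pk) // mp; apply: cost_le; rewrite pk /=.
  by rewrite c_eq0 // c_eq0 ?(ltnW kq) // !addr0 ler_wpM2r // ler_nat ltnW.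
rewrite cE //; apply: le_trans (jump_cost_le m_ge0 m_anti m_eq0 c_eq0 c_jump) _.
rewrite -mulrnAr ler_wpM2l ?expR_ge0 // -sumrMnl.
by apply: ler_sum_nat => i /andP[_ ik]; rewrite /m ik.
Qed.

End Correctness.

(** * From the program to the machine run *)

Lemma iter_step_halted (R : realType) (n : nat) (O : {set 'I_n} -> subgraph n)
    (s : store R) r t :
  iter t (step O) (Config [::] s r) = Config [::] s r.
Proof. by elim: t => //= t ->; case: s. Qed.

Theorem theorem4 (R : realType) (req : requirement R) :
  exists (prog : cmd) (p : {poly nat}),
    forall (n k : nat) (G : wgraph R n) (S : 'I_k -> {set 'I_n})
           (O : {set 'I_n} -> subgraph n),
      (0 < k)%N ->
      nested_terminals S ->
      min_spanner_oracle G req O ->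
      let T : nat := p.[(n + k)%N] in
      let final (coins : T.-tuple bool) := run G S O prog T coins in
      let result (coins : T.-tuple bool) : 'I_k -> subgraph n :=
        output n (final coins) in
      (forall coins : T.-tuple bool,
         halted (final coins) /\
         multilevel_spanner G req S (result coins)) /\
      (forall OPT : 'I_k -> subgraph n,
         optimal_multilevel_spanner G req S OPT ->
         coin_expectation (fun coins => total_weight G (result coins))
           <= expR 1 * total_weight G OPT).
Proof.
exists (compile multilevel_prog), (time_bound multilevel_prog).
move=> n k G S O _ S_nested O_min T final result.
have finalE coins :
    final coins = Config [::] (sem O multilevel_prog (input_store G S)) coins.
  have [||| t le_tT run_t] :=
    @compile_run R n O (n + k) multilevel_prog (input_store G S).
  - by [].
  - exact: leq_addr.
  - exact: leq_addl.
  (* The program halts after t <= T steps, and the remaining steps leave a halted configuration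
     unchanged. *)
  have iterT x : iter T (step O) x = iter (T - t) (step O) (iter t (step O) x).
    by rewrite -iterD subnK.
  by rewrite /final /run iterT run_t iter_step_halted.
have [res_spanner res_weight] := result_spanner S_nested O_min.
have resultE coins : result coins = (fun i : 'I_k => result_at G S O i).
  by rewrite /result finalE.
split=> [coins|OPT [OPT_spanner _]].
  by rewrite finalE resultE.
(* No coin is ever read, so the expectation averages a constant over the 2^T coin sequences. *)
rewrite /coin_expectation (eq_bigr (fun=> \sum_(0 <= i < k) weight G (result_at G S O i))).
  rewrite sumr_const card_tuple card_bool -[_ *+ (2 ^ _)]mulr_natr natrX mulfK ?expf_neq0 ?pnatr_eq0 //.
  move: res_weight; rewrite lerMn2r /= => /le_trans; apply.
  by rewrite ler_wpM2l ?expR_ge0 // (weight_at_le O_min OPT_spanner).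
by move=> coins _; rewrite resultE big_mkord.
Qed.
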